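(* Let $A\in\mathcal{B}_n$ be a matrix in linear block form with diagonal blocks $A_{11},\ldots,A_{\eta\eta}$ (as defined in the context). Then the matrix sequence $\{\Gamma(A^m)\}_{m=1}^\infty$ converges if and only if one of the following holds: (i) for each $i=1,\ldots,\eta$, $A_{ii}$ is of order one; (ii) $A_{\eta\eta}$ is of order at least two; (iii) $A_{\eta\eta}$ is of order one whereas there is a diagonal block of order at least two of $PAP^T$, and, if $p$ is the largest index such that $A_{pp}$ is of order at least two, then $$\bigcup_{i=0}^{\eta-p-1}\bigl((i+L_{j_1\to(p+1)})\cap(i+L_{j_2\to(p+1)})\bigr)=\emptyset \text{ or } \mathbb{Z}_{\kappa_p}$$ for any $j_1,j_2$ in $\mathbb{Z}_{\kappa_p}$, where $\Lambda(A)=\{k_1,\ldots,k_s\}$ for some integer $s$, $1\le s\le\kappa_p$.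
   Context: $\mathcal{B}=\{0,1\}$ is the two-element Boolean algebra ($1+1=1$) and $\mathcal{B}_n$ the set of $n\times n$ matrices over $\mathcal{B}$; powers are Boolean powers. For $A\in\mathcal{B}_n$, $\Gamma(A)=(\gamma_{ij})$ is the matrix with $\gamma_{ij}=1$ if $i\ne j$ and the inner product of rows $i$ and $j$ of $A$ is nonzero, and $\gamma_{ij}=0$ otherwise. A sequence of matrices in $\mathcal{B}_n$ converges if it is eventually constant. The digraph of $A$ is the digraph with adjacency matrix $A$; all digraphs are assumed simple (no loops), so $A$ has zero diagonal. A square matrix is irreducible if its digraph is strongly connected (so a block of order one is $[0]$). The index of imprimitivity of an irreducible matrix of order at least two is the gcd of the lengths of all directed cycles of its digraph. $A$ is in linear block form if there is a permutation matrix $P$ of order $n$ such that $PAP^T$ is block upper bidiagonal: its diagonal blocks are irreducible matrices $A_{11},\ldots,A_{\eta\eta}$, its superdiagonal blocks $A_{12},A_{23},\ldots,A_{\eta-1,\eta}$ are nonzero matrices, and all other blocks are zero; moreover, whenever $A_{ii}$ is of order at least two with index of imprimitivity $\kappa_i$, $A_{ii}$ is partitioned (with square diagonal blocks) into $\kappa_i\times\kappa_i$ blocks in cyclic form, the only possibly nonzero blocks being $A^{(ii)}_{12},A^{(ii)}_{23},\ldots,A^{(ii)}_{\kappa_i-1,\kappa_i},A^{(ii)}_{\kappa_i,1}$, where $A^{(ii)}_{k,k+1}$ lies in the $k$th block row and $(k+1)$th block column (indices modulo $\kappa_i$, so $A^{(ii)}_{\kappa_i,\kappa_i+1}=A^{(ii)}_{\kappa_i,1}$).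 Rows and columns below refer to $PAP^T$. In (iii), $A_{p+1,p+1}$ has order one, and $$\Lambda(A):=\{i\in\mathbb{Z}_{\kappa_p} \mid \text{the column through } A_{p+1,p+1} \text{ has an entry } 1 \text{ in some row intersecting } A^{(pp)}_{i,i+1}\}=\{k_1,\ldots,k_s\}.$$ For $j\in\mathbb{Z}_{\kappa_p}$ and an integer $i\ge0$, $$i+L_{j\to(p+1)}:=\{(k_r-j)+i+1\pmod{\kappa_p}\mid r=1,\ldots,s\}\subseteq\mathbb{Z}_{\kappa_p}.$$
   Formalization: In (iii) the condition is required only for distinct j_1, j_2; for j_1 = j_2 the claim fails: with arcs 1→2, 2→1, 1→3 the sequence Γ(A^m) is constantly 0, yet (i), (ii) and the literal (iii) all fail. *)

(* Defs.v *)
From HB Require Import structures.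
From mathcomp Require Import all_boot all_order all_fingroup all_algebra.

Set Implicit Arguments.
Unset Strict Implicit.
Unset Printing Implicit Defensive.

Import GRing.Theory.
Local Open Scope ring_scope.

(* The two-element Boolean algebra.  An alias of bool is needed because the   *)
(* ring structure that MathComp puts on bool itself is the field F_2, in      *)
(* which 1 + 1 = 0; here addition is (||), so that 1 + 1 = 1, and *m and ^+   *)
(* on 'M[boolalg]_n are the Boolean product and the Boolean power.            *)
Definition boolalg : Type := bool.
HB.instance Definition _ := Finite.on boolalg.
HB.instance Definition _ :=
  GRing.isNmodule.Build boolalg orbA orbC orFb.
HB.instance Definition _ :=
  GRing.Nmodule_isComNzSemiRing.Build boolalg
    andbA andbC andTb andb_orl andFb isT.

Definition Gamma n (A : 'M[boolalg]_n) : 'M[boolalg]_n :=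
  \matrix_(i, j)
    (if (i != j) && (\sum_k A i k * A j k != 0) then 1 else 0).

Definition mx_converges n (u : nat -> 'M[boolalg]_n) : Prop :=
  exists (L : 'M[boolalg]_n) (N : nat), forall m, (N <= m)%N -> u m = L.

Definition arc n (A : 'M[boolalg]_n) : rel 'I_n := fun i j => A i j != 0.

Definition irreducible_mx n (A : 'M[boolalg]_n) : bool :=
  [forall i, forall j, connect (arc A) i j].

(* Directed cycles have distinct vertices, hence length at most n.            *)
Definition imprimitivity n (A : 'M[boolalg]_n) : nat :=
  \big[gcdn/0%N]_(1 <= l < n.+1 | [exists c : l.-tuple 'I_n, ucycleb (arc A) c]) l.

(* A witness that A is in linear block form.  The block orders, and inside    *)
(* each diagonal block of order at least two the orders of the cyclic parts,  *)
(* are recorded as families of sizes that sum up to the order of the matrix,  *)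
(* so that the blocks are the library's submxblock up to a cast along these   *)
(* equations.  All blocks and parts are indexed from 0.                       *)
Record linear_block_form n (A : 'M[boolalg]_n) := LinearBlockForm {
  lb_perm : 'S_n;
  (* eta - 1, where eta >= 1 is the number of diagonal blocks *)
  lb_last : nat;
  lb_order : 'I_lb_last.+1 -> nat;
  lb_order_gt0 : forall i, (0 < lb_order i)%N;
  lb_orderE : n = (\sum_i lb_order i)%N;
  lb_block i j : 'M[boolalg]_(lb_order i, lb_order j) :=
    submxblock (castmx (lb_orderE, lb_orderE)
                  (perm_mx lb_perm *m A *m (perm_mx lb_perm)^T)) i j;
  lb_diag : forall i, irreducible_mx (lb_block i i);
  lb_superdiag : forall i j : 'I_lb_last.+1, j = i.+1 :> nat -> lb_block i j != 0;
  lb_off : forall i j : 'I_lb_last.+1,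
    j != i -> j != i.+1 :> nat -> lb_block i j = 0;
  lb_kappa i : nat := imprimitivity (lb_block i i);
  lb_part : forall i, 'I_(lb_kappa i) -> nat;
  lb_part_gt0 : forall i k, (1 < lb_order i)%N -> (0 < lb_part (i := i) k)%N;
  lb_partE : forall i, (1 < lb_order i)%N ->
    lb_order i = (\sum_k lb_part (i := i) k)%N;
  lb_cyclic : forall i (hi : (1 < lb_order i)%N) (k l : 'I_(lb_kappa i)),
    l != ordS k ->
    submxblock (castmx (lb_partE hi, lb_partE hi) (lb_block i i)) k l = 0
}.

Arguments lb_order {n A} _ _.
Arguments lb_block {n A} _ _ _.
Arguments lb_kappa {n A} _ _.

Section LinearBlockForm.
Variables (n : nat) (A : 'M[boolalg]_n) (F : linear_block_form A).
Variables (p : 'I_(lb_last F).+1) (hp : (1 < lb_order F p)%N).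

(* The set Lambda(A), where p is the index of a diagonal block of order at    *)
(* least two that is followed by one of order one.  The column through the    *)
(* latter, restricted to the rows of A_pp, is the block A_{p,p+1}; r ranges   *)
(* over its rows in the k-th block row of the cyclic form of A_pp, and c over *)
(* its only column.                                                           *)
Definition Lambda : {set 'I_(lb_kappa F p)} :=
  [set k | [exists r, exists c,
     submxcol (castmx (lb_partE hp, erefl) (lb_block F p (inord p.+1))) k r c
       == 1]].

(* i + L_{j -> p+1}; l = (k - j) + i + 1 modulo kappa_p is written without    *)
(* the truncated subtraction of nat.                                          *)
Definition shiftL (i : nat) (j : 'I_(lb_kappa F p)) :
    {set 'I_(lb_kappa F p)} :=
  [set l : 'I_(lb_kappa F p) |
     [exists k in Lambda, (l + j == k + i + 1 %[mod lb_kappa F p])%N]].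

End LinearBlockForm.

(* Main.v *)
(* Rows [u] and [v] of A^m meet iff [u] and [v] have a common vertex at the     *)
(* end of walks of length [m]. Once that vertex has an out-neighbour staying   *)
(* in blocks up to the last block [p] of order at least two, the pair keeps    *)
(* meeting forever, which settles (ii). After block [p] the digraph is a path, *)
(* entered from block [p] at the parts in Lambda, and for large [m] a walk of  *)
(* length [m] from part [j] can end exactly at the vertices of part [j + m]    *)
(* modulo kappa. Hence two vertices that never meet inside the blocks up to    *)
(* [p] meet at a large [m] iff [m] lies modulo kappa in a union of the sets    *)
(* appearing in (iii), over the parts that they can reach; for vertices of     *)
(* block [p] itself there is exactly one such pair of parts.                   *)

Require Import Defs.
From mathcomp Require Import all_boot all_order all_fingroup all_algebra.
From mathcomp Require Import zify.
From Stdlib Require Import Classical_Prop.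

Set Implicit Arguments.
Unset Strict Implicit.
Unset Printing Implicit Defensive.

Import GRing.Theory.

Local Open Scope nat_scope.

(** As [Gamma] has finitely many Boolean entries and zero diagonal, convergence means that any two
    distinct vertices have a common end of walks of length m for all large m, or for no large m
    ([Gamma_convergesP]). In block p every arc raises the cyclic part by one ([walk_part]).
    Conversely, long walks exist whenever the parts allow them ([walk_full]), because kappa is a
    difference of lengths of closed walks ([kappa_gap]). So meeting after block p depends on m
    modulo kappa only. The predicate [meet] expresses this, with [prey_meet] and [meet_prey] as the
    two directions, and a periodic condition settles only if it holds always or never. Pairs of
    equal parts impose nothing: vertices reaching the same part meet inside block p, and keep
    meeting. [prey_converges] combines these facts, and [shiftL_meetP] translates [meet] into the
    sets of (iii). *)

Definition eventually (P : nat -> Prop) := exists N, forall m, N <= m -> P m.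

Lemma eventually_forall (T : finType) (P : T -> nat -> Prop) :
  (forall x, eventually (P x)) -> eventually (fun m => forall x, P x m).
Proof.
move=> /fin_all_exists[N hN]; exists (\max_x N x) => m le_m x.
by apply: hN; apply: leq_trans le_m; apply: leq_bigmax.
Qed.

(** * Arithmetic modulo k *)

Lemma eqmodD k a b c d :
  a = b %[mod k] -> c = d %[mod k] -> a + c = b + d %[mod k].
Proof. by move=> eab ecd; rewrite -modnDm eab ecd modnDm. Qed.

Lemma eqmod_addIr k c a b : a + c = b + c %[mod k] -> a = b %[mod k].
Proof. by move/eqP; rewrite eqn_modDr => /eqP. Qed.

Lemma eqmod_subr k a m : 0 < k -> exists c : 'I_k, a = c + m %[mod k].
Proof.
move=> k_gt0; pose c := a + (k - m %% k).
exists (Ordinal (ltn_pmod c k_gt0)); rewrite /= modnDml /c -addnA.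
rewrite -modnDmr -(modnDmr _ m) subnK ?modnn ?addn0 //.
exact: ltnW (ltn_pmod _ _).
Qed.

(** The consecutive numbers q and q + 1 represent every M >= q^2: if M = aq + b with b < q <= a,
    then M = (a - b)q + b(q + 1). Here all is scaled by [k]. *)
Lemma dvdn_combination k q M :
  q * q <= M -> exists s t, k * M = s * (k * q) + t * (k * q + k).
Proof.
case: (posnP q) => [->|q_gt0] leM; first by exists 0, M; nia.
exists (M %/ q - M %% q), (M %% q).
have leq_div : q <= M %/ q by rewrite leq_divRL.
have lt_mod := ltn_pmod M q_gt0.
rewrite {1}(divn_eq M q); move: (M %/ q) (M %% q) leq_div lt_mod => a b ab bq.
rewrite mulnBl mulnDr [b * (_ + _)]mulnDr; nia.
Qed.

(** * Walks of given length, closed walks, common ends *)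

Section Walk.

Variables (T : finType) (e : rel T).

Fixpoint walk m x y : bool :=
  if m is m'.+1 then [exists z, e x z && walk m' z y] else x == y.

Lemma walk0 x : walk 0 x x. Proof. exact: eqxx. Qed.

Lemma walk1 x y : e x y -> walk 1 x y.
Proof. by move=> exy; apply/existsP; exists y; rewrite exy eqxx. Qed.

Lemma walkD m k x y :
  reflect (exists2 z, walk m x z & walk k z y) (walk (m + k) x y).
Proof.
apply: (iffP idP).
  elim: m x => [|m IHm] x; first by move=> xy; exists x => //; apply: walk0.
  case/existsP=> z /andP[exz /IHm[t zt ty]]; exists t => //.
  by apply/existsP; exists z; rewrite exz.
case=> z; elim: m x => [|m IHm] x; first by move/eqP->.
case/existsP=> t /andP[ext tz] zy; apply/existsP; exists t.
by rewrite ext; apply: IHm.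
Qed.

Lemma walk_cat m k x y z : walk m x y -> walk k y z -> walk (m + k) x z.
Proof. by move=> xy yz; apply/walkD; exists y. Qed.

Lemma walk_rcons m x y : walk m.+1 x y -> exists2 z, walk m x z & e z y.
Proof.
rewrite -addn1 => /walkD[z xz /existsP[t /andP[ezt /eqP <-]]].
by exists z.
Qed.

Lemma walk_loop k m x : walk m x x -> walk (k * m) x x.
Proof.
by move=> xx; elim: k => [|k IHk]; [apply: walk0 | apply: walk_cat IHk].
Qed.

Lemma path_walk x s : path e x s -> walk (size s) x (last x s).
Proof.
elim: s x => [|y s IHs] x; first by rewrite /= eqxx.
case/andP=> exy /IHs ys; apply/existsP; exists y; exact/andP.
Qed.

Lemma connect_walk x y : connect e x y -> exists m, walk m x y.
Proof. by case/connectP=> s /path_walk es ->; exists (size s). Qed.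

Lemma cycle_walk s : path.cycle e s -> 0 < size s -> exists x, walk (size s) x x.
Proof.
by case: s => // x s /path_walk; rewrite size_rcons last_rcons; exists x.
Qed.

(** The index of imprimitivity need not be the length of a closed walk at [x], but it is a
    difference of two such lengths: differences, unlike lengths, are stable under gcd. *)
Definition loop_gap x d :=
  exists a b, [/\ walk a x x, walk b x x & a = b + d].

Lemma loop_gap0 x : loop_gap x 0.
Proof. by exists 0, 0; rewrite walk0. Qed.

(** By Bezout, u d1 = v d2 + gcd. So u longer loops of the first pair with v shorter ones of the
    second exceed the opposite choice by the gcd. *)
Lemma loop_gap_gcd x d1 d2 :
  loop_gap x d1 -> loop_gap x d2 -> loop_gap x (gcdn d1 d2).
Proof.
case: (posnP d1) => [->|d1_gt0]; first by rewrite gcd0n.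
case=> a1 [b1 [wa1 wb1 eq1]] [a2 [b2 [wa2 wb2 eq2]]].
case: (egcdnP d2 d1_gt0) => u v eq_uv _.
exists (u * a1 + v * b2), (u * b1 + v * a2).
by split; [apply: walk_cat; apply: walk_loop..|rewrite eq1 eq2 !mulnDr eq_uv; lia].
Qed.

Lemma loop_gap_closed x y l :
  connect e x y -> connect e y x -> walk l y y -> loop_gap x l.
Proof.
move=> /connect_walk[s xy] /connect_walk[t yx] yy.
exists (s + l + t), (s + t).
by split; [apply: walk_cat yx; apply: walk_cat yy|apply: walk_cat yx|lia].
Qed.

(** In terms of competition graphs, [w] is a common prey of [u] and [v] in [m] steps. *)
Definition prey m u v : bool := [exists w, walk m u w && walk m v w].

Lemma preyP m u v :
  reflect (exists w, walk m u w /\ walk m v w) (prey m u v).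
Proof. by apply: (iffP existsP) => [][w] => [/andP|/andP] ?; exists w. Qed.

Lemma prey_persists (P : pred T) u v m w :
    (forall x, P x -> exists2 y, e x y & P y) ->
    P w -> walk m u w -> walk m v w -> eventually (fun k => prey k u v).
Proof.
move=> out Pw uw vw.
have ext j : exists2 y, walk j w y & P y.
  elim: j => [|j [y wy /out[z eyz Pz]]]; first by exists w; rewrite ?walk0.
  by exists z => //; rewrite -addn1; apply: walk_cat wy (walk1 eyz).
exists m => k /subnKC <-; have [y wy _] := ext (k - m).
by apply/preyP; exists y; split; apply: walk_cat wy.
Qed.

End Walk.

Lemma walk_homo (T T' : finType) (e : rel T) (e' : rel T') (f : T -> T') :
  (forall x y, e x y -> e' (f x) (f y)) ->
  forall m x y, walk e m x y -> walk e' m (f x) (f y).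
Proof.
move=> fe; elim=> [|m IHm] x y; first by move/eqP->; apply: walk0.
case/existsP=> z /andP[exz zy]; apply/existsP; exists (f z).
by rewrite fe //; apply: IHm.
Qed.

(* The digraph of a matrix in linear block form as seen from its last block   *)
(* of order at least two, here block [p]: [b] numbers the blocks, [L] is the  *)
(* last one, and the blocks after [p] form a path.                            *)
Section Tail.

Variables (T : finType) (e : rel T) (b : T -> nat) (p L : nat).
Hypothesis step : forall u v, e u v -> b v = b u \/ b v = (b u).+1.

Lemma walk_mono m u w : walk e m u w -> b u <= b w.
Proof.
elim: m u => [|m IHm] u; first by move/eqP->.
by case/existsP=> z /andP[/step ez /IHm]; case: ez => ->; lia.
Qed.

Hypothesis b_le : forall u, b u <= L.
Hypothesis link :
  forall i, i < L -> exists u v, [/\ b u = i, b v = i.+1 & e u v].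
Hypothesis tail_inj : forall u v, p < b u -> b v = b u -> v = u.
Hypothesis tail_irr : forall u, p < b u -> ~~ e u u.
Hypothesis out : forall u, b u <= p -> exists2 v, e u v & b v <= p.

Variables (k : nat) (part : T -> nat).
Hypothesis k_gt0 : 0 < k.
Hypothesis part_onto : forall i, i < k -> exists2 x, b x = p & part x = i.
Hypothesis part_step : forall x y, b x = p -> b y = p -> e x y ->
  part y = (part x).+1 %[mod k].
Hypothesis conn : forall x y, b x = p -> b y = p -> connect e x y.
Hypothesis gap : forall x, b x = p -> loop_gap e x k.

Definition exit_vertex x := (b x == p) && [exists y, (b y == p.+1) && e x y].

(* [meet c d m] says that [m] lies, modulo [k], in the union over [i] of      *)
(* (i + L_{c -> p+1}) :&: (i + L_{d -> p+1}).                                 *)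
Definition meet c d m := exists i x1 x2,
  [/\ i < L - p, exit_vertex x1, exit_vertex x2,
      part x1 + i.+1 = c + m %[mod k] & part x2 + i.+1 = d + m %[mod k]].

(** [c] is a part whose vertices in block [p] keep pace with [u]. A vertex before block [p] may have
    several such parts modulo [k], a vertex of block [p] only its own. *)
Definition reached u c :=
  exists m x, [/\ b x = p, walk e m u x & part x = c + m %[mod k]].

Lemma meet_eqmod c d m c' d' m' :
  c = c' %[mod k] -> d = d' %[mod k] -> m = m' %[mod k] ->
  meet c d m -> meet c' d' m'.
Proof.
move=> ec ed em [i [x1 [x2 [ltiL ex1 ex2 h1 h2]]]]; exists i, x1, x2.
by split; rewrite // ?h1 ?h2; apply: eqmodD.
Qed.

(** * Walks inside block p *)

Lemma walk_part m x y : b x = p -> b y = p -> walk e m x y ->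
  part y = part x + m %[mod k].
Proof.
elim: m x => [|m IHm] x bx by_; first by move/eqP->; rewrite addn0.
case/existsP=> z /andP[exz zy].
have bz : b z = p by have := walk_mono zy; case: (step exz); lia.
rewrite (IHm z) // addnS -addSn; apply: eqmodD => //; exact: part_step.
Qed.

(* Two loops at [x] whose lengths differ by [k] have lengths kq and kq + k,    *)
(* and every large multiple of [k] is a sum of these.                         *)
Lemma walk_full x y : b x = p -> b y = p ->
  eventually (fun m => part y = part x + m %[mod k] -> walk e m x y).
Proof.
move=> bx by_; have [n0 xy] := connect_walk (conn bx by_).
have [a [c [xa xc eac]]] := gap bx.
have /dvdnP[q ec] : k %| c.
  have := walk_part bx bx xc; rewrite -[in LHS](addn0 (part x)) => /eqP.
  by rewrite eqn_modDl mod0n eq_sym.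
exists (n0 + k * (q * q)) => m le_m emod.
have /dvdnP[M eM] : k %| m - n0.
  rewrite -eqn_mod_dvd; last lia.
  by rewrite -(eqn_modDl (part x)) -emod -(walk_part bx by_ xy).
have leM : q * q <= M by rewrite -(leq_pmul2l k_gt0); lia.
have [s [t est]] := dvdn_combination k leM.
have -> : m = (s * c + t * a) + n0.
  by rewrite eac ec [q * k]mulnC -est mulnC -eM subnK; lia.
by apply: walk_cat xy; apply: walk_cat; apply: walk_loop.
Qed.

Lemma reached_full u c : reached u c ->
  eventually (fun m =>
    forall y, b y = p -> part y = c + m %[mod k] -> walk e m u y).
Proof.
case=> m0 [x [bx ux ex]].
have /eventually_forall[N hN] y : eventually (fun m =>
    b y = p -> part y = part x + m %[mod k] -> walk e m x y).
  case: (b y =P p) => [by_|]; last by exists 0.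
  by have [N hN] := walk_full bx by_; exists N => m le_m _; apply: hN.
exists (m0 + N) => m le_m y by_ ey.
have -> : m = m0 + (m - m0) by lia.
apply: walk_cat ux (hN _ _ _ _ _) => //; first lia.
rewrite ey; have {1}-> : c + m = (c + m0) + (m - m0) by lia.
exact: eqmodD.
Qed.

Lemma reached_part u c : b u = p -> reached u c -> c = part u %[mod k].
Proof.
move=> bu [m [x [bx ux ex]]]; apply: (@eqmod_addIr _ m).
by rewrite -ex; apply: walk_part.
Qed.

Lemma reached_self u : b u = p -> reached u (part u).
Proof. by move=> bu; exists 0, u; rewrite walk0 addn0. Qed.

(** * Walks along the path after block p *)

Lemma tail_walk m u w : p < b u -> walk e m u w -> b w = b u + m.
Proof.
elim: m u => [|m IHm] u pu; first by move/eqP->; rewrite addn0.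
case/existsP=> z /andP[euz zw]; case: (step euz) => bz.
  by have ez := tail_inj pu bz; move: euz; rewrite ez (negPf (tail_irr pu)).
by rewrite (IHm z) //; lia.
Qed.

Lemma tail_prey u v : p < b u -> eventually (fun m => ~~ prey e m u v).
Proof.
move=> pu; exists L.+1 => m le_m; apply/negP=> /preyP[w [uw _]].
by have := tail_walk pu uw; have := b_le w; lia.
Qed.

(** After block [p] the way to [w] is forced, so the last b w - p arcs follow the path from an exit
    vertex. *)
Lemma walk_exit m u w : b u <= p -> p < b w -> walk e m u w ->
  exists m' x, [/\ m = m' + (b w - p), exit_vertex x & walk e m' u x].
Proof.
move=> bu; elim: m w => [|m IHm] w pw; first by move/eqP=> uw; rewrite uw in bu; lia.
case/walk_rcons=> z uz ezw; case: (step ezw) => bw.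
  have ez : w = z by apply: tail_inj; lia.
  by move: ezw; rewrite -ez (negPf (tail_irr pw)).
case: (ltngtP (b z) p) => [|pz|bz]; first lia.
  have [m' [x [em ex ux]]] := IHm z pz uz.
  by exists m', x; split=> //; lia.
exists m, z; split=> //; first lia.
rewrite /exit_vertex bz eqxx; apply/existsP; exists w.
by rewrite bw bz eqxx.
Qed.

Lemma exit_walk m u x w :
  exit_vertex x -> walk e m u x -> p < b w -> walk e (m + (b w - p)) u w.
Proof.
move=> ex ux pw; have {pw}[i bw] : exists i, b w = p + i.+1.
  by exists (b w - p).-1; lia.
have -> : b w - p = i.+1 by lia.
elim: i => [|i IHi] in w bw *.
  case/andP: ex => _ /existsP[y /andP[/eqP ey exy]].
  have -> : w = y by apply: tail_inj; lia.
  exact: walk_cat ux (walk1 exy).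
have [|z [t [bz bt ezt]]] := @link (p + i.+1); first by have := b_le w; lia.
have -> : w = t by apply: tail_inj; lia.
rewrite -(addn1 i.+1) addnA; apply: walk_cat (walk1 ezt); exact: IHi.
Qed.

(** The index i in [meet] names a vertex of block p + i + 1. For large [m] both vertices reach
    suitable exit vertices in m - i - 1 steps, and the path supplies the other i + 1. *)
Lemma meet_prey u v c d : reached u c -> reached v d ->
  eventually (fun m => meet c d m -> prey e m u v).
Proof.
move=> /reached_full[N1 h1] /reached_full[N2 h2].
exists (N1 + N2 + L) => m le_m [i [x1 [x2 [ltiL ex1 ex2 e1 e2]]]].
have [z [w [_ bw _]]] : exists z w, [/\ b z = p + i, b w = (p + i).+1 & e z w].
  by apply: link; lia.
have pw : p < b w by rewrite bw ltnS leq_addr.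
have ei : b w - p = i.+1 by rewrite bw -addnS addKn.
have le_m' : N1 + N2 <= m - i.+1 by clear -le_m ltiL; lia.
have em : m = (m - i.+1) + i.+1 by clear -le_m ltiL; lia.
have reach u' c' x N :
    (forall m', N <= m' -> forall y, b y = p ->
       part y = c' + m' %[mod k] -> walk e m' u' y) ->
    N <= N1 + N2 -> exit_vertex x -> part x + i.+1 = c' + m %[mod k] ->
    walk e m u' w.
  move=> h leN ex epart; rewrite em -ei; apply: (exit_walk ex) => //.
  case/andP: (ex) => /eqP bx _; rewrite ei; apply: h => //.
    exact: leq_trans le_m'.
  by apply: (@eqmod_addIr _ i.+1); rewrite epart -addnA -em.
apply/preyP; exists w; split.
  exact: reach h1 (leq_addr _ _) ex1 e1.
exact: reach h2 (leq_addl _ _) ex2 e2.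
Qed.

(** Both walks end with equally many forced arcs, so they reach their exit vertices after the same
    time. Counting back from the parts of these vertices gives [c] and [d], for every [m] and not
    only for large ones. *)
Lemma prey_meet u v m w : b u <= p -> b v <= p -> p < b w ->
  walk e m u w -> walk e m v w ->
  exists c d : 'I_k, [/\ reached u c, reached v d & meet c d m].
Proof.
move=> bu bv pw /(walk_exit bu pw)[m1 [x1 [em1 ex1 ux1]]].
case/(walk_exit bv pw)=> m2 [x2 [em2 ex2 vx2]].
have em : m2 = m1 by lia.
rewrite {}em {em2} in vx2.
have [c ec] := eqmod_subr (part x1) m1 k_gt0.
have [d ed] := eqmod_subr (part x2) m1 k_gt0.
have bx x : exit_vertex x -> b x = p by case/andP=> /eqP.
exists c, d; split; first by exists m1, x1; split=> //; apply: bx.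
  by exists m1, x2; split=> //; apply: bx.
exists (b w - p).-1, x1, x2; have := b_le w.
have -> : (b w - p).-1.+1 = b w - p by lia.
by split=> //; [lia|rewrite em1 addnA; apply: eqmodD..].
Qed.

Lemma prey_converges :
  (forall u v, u != v ->
     eventually (fun m => prey e m u v) \/ eventually (fun m => ~~ prey e m u v))
  <-> (forall c d : 'I_k, c != d ->
         (forall m, ~ meet c d m) \/ (forall m, meet c d m)).
Proof.
split=> [conv c d neq_cd | dich u v _].
  have [u bu pu] := part_onto (ltn_ord c).
  have [v bv pv] := part_onto (ltn_ord d).
  have neq_mod : ~ (c = d %[mod k]).
    by rewrite !modn_small // => /val_inj ecd; rewrite ecd eqxx in neq_cd.
  have neq_uv : u != v.
    by apply: contra_neq neq_cd => euv; apply: val_inj; rewrite /= -pu -pv euv.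
  (* Adding a multiple of [k] pushes [m] past any threshold without affecting [meet]. *)
  have shift m N : m = m + N * k %[mod k] by rewrite addnC modnMDl.
  have le_shift m N : N <= m + N * k.
    exact: leq_trans (leq_pmulr N k_gt0) (leq_addl _ _).
  case: (conv u v neq_uv) => -[N hN].
    right=> m; have /hN/preyP[w [uw vw]] := le_shift m N.
    have := walk_mono uw; rewrite bu leq_eqVlt => /orP[/eqP/esym bw|pw].
      case: neq_mod; rewrite -pu -pv; apply: (@eqmod_addIr _ (m + N * k)).
      by rewrite -(walk_part bu bw uw) (walk_part bv bw vw).
    have [|| c' [d' [rc rd]]] := prey_meet _ _ pw uw vw; rewrite ?bu ?bv //.
    apply: meet_eqmod; last exact/esym/shift.
      by rewrite -pu; apply: reached_part.
    by rewrite -pv; apply: reached_part.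
  left=> m cdm; have rc := reached_self bu; have rd := reached_self bv.
  rewrite pu in rc; rewrite pv in rd; have [N' hN'] := meet_prey rc rd.
  have /negP[] : ~~ prey e (m + (N + N') * k) u v by apply: hN; apply: leq_trans (le_shift _ _); apply: leq_addr.
  apply: hN'; first exact: leq_trans (leq_addl _ _) (le_shift _ _).
  by apply: meet_eqmod cdm.
case: (ltnP p (b u)) => [/tail_prey|bu]; first by right.
case: (ltnP p (b v)) => [pv|bv].
  right; have [N hN] := tail_prey u pv; exists N => m /hN; apply: contraNN.
  by case/preyP=> w [uw vw]; apply/preyP; exists w.
(* One meeting at or before block [p] lasts forever; otherwise all common ends lie after block
   [p]. *)
case: (classic (exists m w, [/\ b w <= p, walk e m u w & walk e m v w])).
  by case=> m [w [bw uw vw]]; left; apply: (prey_persists (P := fun x => b x <= p)) bw uw vw.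
move=> apart.
(* A part reached by both would yield a common end inside block [p]. *)
have disj (c : nat) : reached u c -> ~ reached v c.
  case/reached_full=> [N1 h1] /reached_full[N2 h2]; apply: apart.
  have [y bY ey] := part_onto (ltn_pmod (c + (N1 + N2)) k_gt0).
  have eyc : part y = c + (N1 + N2) %[mod k] by rewrite ey modn_mod.
  by exists (N1 + N2), y; split; [lia|apply: h1|apply: h2] => //; lia.
case: (classic (exists c d, [/\ reached u c, reached v d &
                                forall m, meet c d m])).
  case=> c [d [rc rd all_meet]]; left.
  by have [N hN] := meet_prey rc rd; exists N => m /hN; apply.
(* A single common end would yield parts that meet at [m], hence always, contrary to [never]. *)
move=> never; right; exists 0 => m _; apply/negP=> /preyP[w [uw vw]].
have pw : p < b w by rewrite ltnNge; apply/negP=> bw; apply: apart; exists m, w.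
have [c [d [rc rd cdm]]] := prey_meet bu bv pw uw vw.
have neq_cd : c != d by apply/eqP=> ecd; rewrite ecd in rc; apply: disj rc rd.
case: (dich c d neq_cd) => [/(_ m)//|all_meet].
by apply: never; exists c, d.
Qed.

End Tail.

Local Open Scope ring_scope.
(* The import of path shadows the relation of Defs. *)
Local Notation arc := Defs.arc.

(** * Boolean powers as walks *)

Lemma boolalg_sum_neq0 (I : finType) (f : I -> boolalg) :
  (\sum_i f i != 0) = [exists i, f i != 0].
Proof.
apply/idP/existsP => [|[i fi]].
  move=> nz; apply/existsP; apply: contraNT nz => /existsPn no_i.
  by apply/eqP/big1 => i _; apply/eqP; rewrite -[_ == _]negbK; apply: no_i.
by rewrite (bigD1 i) //=; case: (f i) fi.
Qed.

Lemma boolalg_mul_neq0 (x y : boolalg) : (x * y != 0) = (x != 0) && (y != 0).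
Proof. by case: x; case: y. Qed.

Lemma arc_exp n (A : 'M[boolalg]_n) m i j : arc (A ^+ m) i j = walk (arc A) m i j.
Proof.
elim: m i => [|m IHm] i; first by rewrite /Defs.arc expr0 mxE /=; case: (i == j).
rewrite exprS {1}/Defs.arc mxE boolalg_sum_neq0 /=; apply: eq_existsb => z.
by rewrite boolalg_mul_neq0 -IHm.
Qed.

Lemma Gamma_exp n (A : 'M[boolalg]_n) m i j :
  Gamma (A ^+ m) i j = (i != j) && prey (arc A) m i j.
Proof.
rewrite /Gamma mxE boolalg_sum_neq0; case: (i != j) => //=.
suff -> : [exists z, (A ^+ m) i z * (A ^+ m) j z != 0] = prey (arc A) m i j.
  by case: prey.
apply: eq_existsb => z.
by rewrite boolalg_mul_neq0 -/(arc _ i z) -/(arc _ j z) !arc_exp.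
Qed.

Lemma Gamma_convergesP n (A : 'M[boolalg]_n) :
  mx_converges (fun m => Gamma (A ^+ m.+1)) <->
  (forall i j, i != j ->
     eventually (fun m => prey (arc A) m i j) \/
     eventually (fun m => ~~ prey (arc A) m i j)).
Proof.
split=> [[L [N hN]] i j neq_ij | conv].
  have preyE m : (N < m)%N -> prey (arc A) m i j = L i j.
    by case: m => // m /hN <-; rewrite Gamma_exp neq_ij.
  by case Lij: (L i j); [left | right]; exists N.+1 => m /preyE ->; rewrite Lij.
have /fin_all_exists[l hl] (ij : 'I_n * 'I_n) :
    exists l : boolalg, eventually (fun m => Gamma (A ^+ m.+1) ij.1 ij.2 = l).
  case: ij => i j /=; have [<-|neq_ij] := eqVneq i j.
    by exists 0, 0%N => m _; rewrite Gamma_exp eqxx.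
  case: (conv i j neq_ij) => -[N hN]; [exists 1 | exists 0]; exists N => m le_m.
    by rewrite Gamma_exp neq_ij hN // ltnW.
  by rewrite Gamma_exp neq_ij /=; apply/negbTE/hN/ltnW.
have [N hN] := eventually_forall hl.
exists (\matrix_(i, j) l (i, j)), N => m le_m; apply/matrixP=> i j.
by rewrite (hN m le_m (i, j)) mxE.
Qed.

(** * The digraph of a linear block form *)

Section Blocks.

Variables (n : nat) (A : 'M[boolalg]_n) (F : linear_block_form A).

(** Row k of PAP^T comes from row [lb_perm] k of A, hence the permutation here and its inverse in
    [blk]. *)
Definition vtx i (a : 'I_(lb_order F i)) : 'I_n :=
  lb_perm F (cast_ord (esym (lb_orderE F)) (tagnat.Rank i a)).

Definition blk (v : 'I_n) : 'I_(lb_last F).+1 :=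
  tagnat.sig1 (cast_ord (lb_orderE F) ((lb_perm F)^-1%g v)).

Lemma lb_blockE i j a b : lb_block F i j a b = A (vtx a) (vtx b).
Proof.
by rewrite /lb_block mxE castmxE -row_permE tr_perm_mx -col_permE !mxE.
Qed.

Lemma arc_vtx i j (a : 'I_(lb_order F i)) (b : 'I_(lb_order F j)) :
  arc A (vtx a) (vtx b) = (lb_block F i j a b != 0).
Proof. by rewrite lb_blockE. Qed.

Lemma blk_vtx i (a : 'I_(lb_order F i)) : blk (vtx a) = i.
Proof. by rewrite /blk /vtx permK cast_ordKV tagnat.Rank1K. Qed.

Lemma vtx_onto v : exists a : 'I_(lb_order F (blk v)), v = vtx a.
Proof.
exists (tagnat.sig2 (cast_ord (lb_orderE F) ((lb_perm F)^-1%g v))).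
by rewrite /vtx tagnat.sig2K cast_ordK permKV.
Qed.

Lemma vtx_ontoP i v : blk v = i -> exists a : 'I_(lb_order F i), v = vtx a.
Proof. by move=> <-; apply: vtx_onto. Qed.

Lemma vtx_inj i : injective (@vtx i).
Proof.
move=> a b /perm_inj/cast_ord_inj/eqP.
by rewrite -val_eqE tagnat.eq_Rank eqxx => /eqP/val_inj.
Qed.

Lemma blk_step u v : arc A u v ->
  blk v = blk u :> nat \/ blk v = (blk u).+1 :> nat.
Proof.
have [a ea] := vtx_onto u; have [b eb] := vtx_onto v.
rewrite {1}ea {1}eb arc_vtx => h.
have [->|ne1] := eqVneq (blk v) (blk u); first by left.
have [->|ne2] := eqVneq (blk v : nat) (blk u).+1; first by right.
by rewrite lb_off // mxE eqxx in h.
Qed.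

Lemma blk_link i : (i < lb_last F)%N ->
  exists u v, [/\ blk u = i :> nat, blk v = i.+1 :> nat & arc A u v].
Proof.
move=> lti; pose i0 := Ordinal (ltnW lti : (i < (lb_last F).+1)%N).
pose i1 := Ordinal (lti : (i.+1 < (lb_last F).+1)%N).
have := @lb_superdiag _ _ F i0 i1 erefl.
case: (boolP [exists a, exists b, lb_block F i0 i1 a b != 0]).
  case/existsP=> a /existsP[b h] _; exists (vtx a), (vtx b).
  by rewrite !blk_vtx arc_vtx.
move=> none /eqP[]; apply/matrixP=> a b; rewrite [RHS]mxE; apply/eqP.
by apply: contraNT none => h; apply/existsP; exists a; apply/existsP; exists b.
Qed.

Lemma blk_connect u v : blk u = blk v -> connect (arc A) u v.
Proof.
have [a ->] := vtx_onto u.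
rewrite blk_vtx => euv; have [b ->] := vtx_ontoP (esym euv).
have /forallP/(_ a)/forallP/(_ b)/connectP[s path_s ->] := @lb_diag _ _ F (blk u).
elim: s a path_s => [|c s IHs] a /=; first by rewrite connect0.
case/andP=> eac /IHs; apply: connect_trans; apply: connect1.
by rewrite arc_vtx.
Qed.

Lemma blk_order1 u v : lb_order F (blk u) = 1%N -> blk v = blk u -> v = u.
Proof.
have [a ->] := vtx_onto u; rewrite blk_vtx => ord1 /vtx_ontoP[b ->].
have ord0 (c : 'I_(lb_order F (blk u))) : c = 0%N :> nat.
  by have := ltn_ord c; move: (nat_of_ord c) => m; rewrite ord1; case: m.
by congr vtx; apply: val_inj; rewrite /= !ord0.
Qed.

(** In a block of order at least two, a path to another vertex of the block starts with a suitable
    arc. From a block of order one before [p], the nonzero superdiagonal block gives one. *)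
Lemma blk_out p u : ((blk u < p) || (1 < lb_order F (blk u)))%N ->
  (blk u <= p <= lb_last F)%N -> exists2 v, arc A u v & (blk v <= p)%N.
Proof.
move=> big /andP[leup lepL]; have [gt1|le1] := ltnP 1 (lb_order F (blk u)).
  have [v buv neq_uv] : exists2 v, blk v = blk u & v != u.
    have [a ea] := vtx_onto u.
    have [c neq_ca] : exists c, c != a.
      apply/existsP; rewrite -negb_forall; apply/negP=> /forallP eq_a.
      have : (#|'I_(lb_order F (blk u))| <= 1)%N.
        by apply/card_le1_eqP=> x y _ _; rewrite (eqP (eq_a x)) (eqP (eq_a y)).
      by rewrite card_ord leqNgt gt1.
    exists (vtx c); first exact: blk_vtx.
    by apply: contra_neq neq_ca => ec; apply: vtx_inj; apply: etrans ec ea.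
  have [[|w s] /= path_s ev] := connectP (blk_connect (esym buv)).
    by rewrite ev eqxx in neq_uv.
  case/andP: path_s => uw /path_walk; rewrite -ev => wv; exists w => //.
  have : (blk w <= blk v)%N by exact: (walk_mono (b := fun v => blk v) blk_step wv).
  by rewrite buv => /leq_trans; apply.
have ltup : (blk u < p)%N by case/orP: big => //; rewrite ltnNge le1.
have [x [y [bx by_ xy]]] := blk_link (leq_trans ltup lepL).
have ex : x = u.
  apply: blk_order1; last exact: val_inj.
  by apply/eqP; rewrite eqn_leq le1 lb_order_gt0.
by exists y; rewrite -?ex // by_.
Qed.

(** * Cyclic parts of block p and the set Lambda *)

Section Parts.

Variables (p : 'I_(lb_last F).+1) (hp : (1 < lb_order F p)%N).

Definition cyclic_part (a : 'I_(lb_order F p)) : 'I_(lb_kappa F p) :=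
  tagnat.sig1 (cast_ord (lb_partE hp) a).

(* Junk value 0 outside block [p]. *)
Definition part v : nat :=
  if [pick a : 'I_(lb_order F p) | vtx a == v] is Some a
  then cyclic_part a else 0%N.

Lemma part_vtx (a : 'I_(lb_order F p)) : part (vtx a) = cyclic_part a.
Proof.
rewrite /part; case: pickP => [c /eqP/vtx_inj-> //|/(_ a)].
by rewrite eqxx.
Qed.

(** A gcd could be 0, but a vertex of the block lies in some part. *)
Lemma kappa_gt0 : (0 < lb_kappa F p)%N.
Proof.
exact: leq_ltn_trans (leq0n _) (ltn_ord (cyclic_part (Ordinal (ltnW hp)))).
Qed.

Lemma part_onto i : (i < lb_kappa F p)%N ->
  exists2 x, blk x = p :> nat & part x = i.
Proof.
move=> lti; pose k := Ordinal lti; pose r := Ordinal (lb_part_gt0 k hp).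
exists (vtx (cast_ord (esym (lb_partE hp)) (tagnat.Rank k r))).
  by rewrite blk_vtx.
by rewrite part_vtx /cyclic_part cast_ordKV tagnat.Rank1K.
Qed.

Lemma part_step x y : blk x = p :> nat -> blk y = p :> nat -> arc A x y ->
  part y = (part x).+1 %[mod lb_kappa F p].
Proof.
move=> /val_inj/vtx_ontoP[a ->] /val_inj/vtx_ontoP[c ->].
rewrite arc_vtx !part_vtx => nz.
have [-> /=|ne] := eqVneq (cyclic_part c) (ordS (cyclic_part a)).
  by rewrite modn_mod.
case/negP: nz; apply/eqP; have /matrixP := @lb_cyclic _ _ F p hp _ _ ne.
move/(_ (tagnat.sig2 (cast_ord (lb_partE hp) a))
        (tagnat.sig2 (cast_ord (lb_partE hp) c))).
by rewrite [LHS]mxE castmxE !tagnat.sig2K !cast_ordK [RHS]mxE.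
Qed.

Lemma kappa_gap x : blk x = p :> nat -> loop_gap (arc A) x (lb_kappa F p).
Proof.
move=> bx; rewrite /lb_kappa /imprimitivity.
apply: big_ind => [|d1 d2|l]; [exact: loop_gap0|exact: loop_gap_gcd|].
(* The induction over the gcd forgets that [l] is at least 1, so length 0 is a case of its own. *)
case/existsP=> c /andP[cyc _]; have [->|l_gt0] := posnP l.
  exact: loop_gap0.
have [|y] := cycle_walk cyc; first by rewrite size_tuple.
rewrite size_tuple => /(walk_homo (e' := arc A) (f := @vtx p)) yy.
apply: (loop_gap_closed (y := vtx y)); last by apply: yy => a b; rewrite arc_vtx.
  by apply: blk_connect; rewrite blk_vtx; apply: val_inj.
by apply: blk_connect; rewrite blk_vtx; apply: val_inj.
Qed.

Hypothesis ltpL : (p < lb_last F)%N.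

(** By [ltpL], [inord p.+1] is the index after [p], so the exit arcs are the nonzero entries of the
    block A_{p,p+1}. *)
Lemma LambdaP (k : 'I_(lb_kappa F p)) :
  reflect (exists2 x, exit_vertex (arc A) (fun v => blk v) p x & part x = k)
          (k \in Lambda hp).
Proof.
have bE (x : boolalg) : (x == 1) = (x != 0) by case: x.
rewrite inE; apply: (iffP existsP) => [[r /existsP[c]]|[x]].
  rewrite bE mxE castmxE -arc_vtx => xy.
  exists (vtx (cast_ord (esym (lb_partE hp)) (tagnat.Rank k r))).
    rewrite /exit_vertex blk_vtx eqxx; apply/existsP.
    exists (vtx (cast_ord (esym erefl) c)); apply/andP; split; last exact: xy.
    by rewrite blk_vtx inordK.
  by rewrite part_vtx /cyclic_part cast_ordKV tagnat.Rank1K.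
case/andP=> /eqP/val_inj/vtx_ontoP[a ->] /existsP[y /andP[/eqP by_]].
have {by_}/vtx_ontoP[c ->] : blk y = inord p.+1.
  by apply: val_inj; rewrite /= by_ inordK.
rewrite arc_vtx part_vtx => nz /val_inj <-.
exists (tagnat.sig2 (cast_ord (lb_partE hp) a)); apply/existsP; exists c.
by rewrite bE mxE castmxE tagnat.sig2K cast_ordK cast_ord_id.
Qed.

(** Blocks count from 0, so [i] ranges over as many values as there are blocks after [p]. Membership
    of l in i + L_j says k + i + 1 = j + l modulo kappa for the part k of some exit vertex. *)
Lemma shiftL_meetP (c d l : 'I_(lb_kappa F p)) :
  reflect (meet (arc A) (fun v => blk v) p (lb_last F) (lb_kappa F p) part c d l)
    (l \in \bigcup_(i < (lb_last F).+1 - p.+1)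
             (shiftL hp i c :&: shiftL hp i d)).
Proof.
have shiftLP i (j : 'I_(lb_kappa F p)) : reflect
    (exists2 x, exit_vertex (arc A) (fun v => blk v) p x &
       (part x + i.+1 = j + l %[mod lb_kappa F p])%N) (l \in shiftL hp i j).
  rewrite inE; apply: (iffP exists_inP) => [[k /LambdaP[x ex px] /eqP h]|[x ex h]].
    by exists x => //; rewrite px (addnC (j : nat)) h -addnA addn1.
  have /andP[/eqP/val_inj/vtx_ontoP[a ea] _] := ex.
  exists (cyclic_part a); first by apply/LambdaP; exists x; rewrite // ea part_vtx.
  by rewrite -part_vtx -ea -addnA addn1 h addnC.
apply: (iffP bigcupP) => [[i _]|[i [x1 [x2 [lti ex1 ex2 h1 h2]]]]].
  rewrite inE => /andP[/shiftLP[x1 ex1 h1] /shiftLP[x2 ex2 h2]].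
  by exists i, x1, x2; split=> //; have := ltn_ord i; rewrite subSS.
rewrite -subSS in lti; exists (Ordinal lti) => //.
by rewrite inE; apply/andP; split; apply/shiftLP; [exists x1 | exists x2].
Qed.

End Parts.

End Blocks.

(** * The three cases *)

Theorem corollary2p5 (n : nat) (A : 'M[boolalg]_n)
    (simpleA : forall v : 'I_n, A v v = 0) (F : linear_block_form A) :
  mx_converges (fun m => Gamma (A ^+ m.+1)) <->
  [\/ forall i, lb_order F i = 1%N,
      (2 <= lb_order F ord_max)%N
    | [/\ lb_order F ord_max = 1%N,
          exists i, (2 <= lb_order F i)%N
        & forall (p : 'I_(lb_last F).+1) (hp : (1 < lb_order F p)%N),
            (forall q : 'I_(lb_last F).+1, (2 <= lb_order F q)%N -> (q <= p)%N) ->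
            forall j1 j2 : 'I_(lb_kappa F p), j1 != j2 ->
              let U := \bigcup_(i < (lb_last F).+1 - p.+1)
                         (shiftL hp i j1 :&: shiftL hp i j2) in
              U = set0 \/ U = setT]].
Proof.
rewrite Gamma_convergesP.
have irr u : ~~ arc A u u by rewrite /Defs.arc simpleA eqxx.
have order1 i : ~~ (1 < lb_order F i)%N -> lb_order F i = 1%N.
  by rewrite -leqNgt => le1; apply/eqP; rewrite eqn_leq le1 lb_order_gt0.
have b_le v : (blk F v <= lb_last F)%N by rewrite -ltnS.
have [big_last|small_last] := boolP (1 < lb_order F ord_max)%N.
  split=> [_|_ u v _]; first exact: Or32.
  case: (classic (exists m, prey (arc A) m u v)) => [[m /preyP[w [uw vw]]]|none].
    left; apply: (prey_persists (P := xpredT)) uw vw => // x _.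
    (* Taken at the last block, [blk_out] gives every vertex an out-neighbour, so one meeting
       suffices. *)
    have [||y xy _] := @blk_out _ _ F (lb_last F) x; rewrite ?b_le ?leqnn //.
      case: ltngtP (b_le x) => //= bx _.
      by rewrite (_ : blk F x = ord_max) //; apply: val_inj.
    by exists y.
  by right; exists 0%N => m _; apply/negP=> h; apply: none; exists m.
have [/existsP[q0 big0]|all1] := boolP [exists q, 1 < lb_order F q]%N; last first.
  have ord1 i : lb_order F i = 1%N.
    by apply: order1; move: all1; rewrite negb_exists => /forallP.
  split=> [_|_ u v _]; first exact: Or31.
  (* All blocks are single loopless vertices: each arc moves one block on, and long walks do not
     exist. *)
  right; exists (lb_last F).+1 => m le_m; apply/negP=> /preyP[w [uw _]].
  have stay x y m' : walk (arc A) m' x y -> (blk F y = blk F x + m' :> nat)%N.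
    elim: m' x => [|m' IHm] x; first by move/eqP->; rewrite addn0.
    case/existsP=> z /andP[exz /IHm ->]; case: (blk_step F exz) => [/val_inj bz|->].
      by have ez := blk_order1 (ord1 _) bz; rewrite ez (negPf (irr x)) in exz.
    by rewrite addSnnS.
  by have := b_le w; rewrite (stay _ _ _ uw) leqNgt (leq_trans le_m) ?leq_addl.
have [p hp pmax] := @arg_maxnP _ q0 (fun q => 1 < lb_order F q)%N (@nat_of_ord _) big0.
have ltpL : (p < lb_last F)%N.
  rewrite ltn_neqAle -ltnS ltn_ord andbT; apply: contraNneq small_last => ep.
  by rewrite (_ : ord_max = p) //; apply: val_inj.
have tail1 u : (p < blk F u)%N -> lb_order F (blk F u) = 1%N.
  by move=> pu; apply: order1; apply/negP=> /pmax; rewrite /= leqNgt pu.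
have conv_dich : (forall u v, u != v ->
    eventually (fun m => prey (arc A) m u v) \/
    eventually (fun m => ~~ prey (arc A) m u v)) <->
  (forall c d : 'I_(lb_kappa F p), c != d ->
    (forall m, ~ meet (arc A) (fun v => blk F v) p (lb_last F) (lb_kappa F p)
                   (part hp) c d m) \/
    (forall m, meet (arc A) (fun v => blk F v) p (lb_last F) (lb_kappa F p)
                 (part hp) c d m)).
  apply: prey_converges => //.
  - exact: blk_step.
  - exact: blk_link.
  - by move=> u v pu /val_inj; apply: blk_order1; apply: tail1.
  - move=> u bu; have [||v] := @blk_out _ _ F p u; last by exists v.
      by case: ltngtP bu => //= /val_inj ->.
    by rewrite bu ltnW.
  - exact: kappa_gt0.
  - exact: part_onto.
  - exact: part_step.
  - by move=> x y bx by_; apply: (@blk_connect _ _ F); apply: val_inj; rewrite /= bx.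
  - exact: kappa_gap.
rewrite {}conv_dich; split=> [dich|[ord1|big_last|[_ _ uni]] c d neq_cd].
- apply: Or33; split; [exact: order1|by exists q0|] => p' hp' pmax'.
  have ep : p' = p.
    have lep : (p' <= p)%N := pmax p' hp'.
    by apply: val_inj; apply/eqP; rewrite eqn_leq lep pmax'.
  (* The types depend on p', so it is replaced by [p] by transport. *)
  case: _ / (esym ep) in hp' pmax' * => c d /dich.
  rewrite (bool_irrelevance hp' hp) {hp'}.
  case=> [never|always] U; [left | right]; apply/setP=> l; rewrite inE.
    by apply/negP=> /(shiftL_meetP hp ltpL)/never.
  exact/(shiftL_meetP hp ltpL).
- by have := hp; rewrite ord1.
- by case/negP: small_last.
(* [meet] concerns all m, the union only residues. *)
have modE m : exists l : 'I_(lb_kappa F p), m = l %[mod lb_kappa F p].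
  exists (Ordinal (ltn_pmod m (kappa_gt0 hp))); by rewrite /= modn_mod.
case: (uni p hp pmax c d neq_cd) => /setP UE; [left | right] => m.
  have [l el] := modE m; move=> /meet_eqmod => /(_ _ _ _ erefl erefl el).
  by move/(shiftL_meetP hp ltpL); rewrite UE inE.
have [l el] := modE m; apply: (meet_eqmod erefl erefl (esym el)).
by apply/(shiftL_meetP hp ltpL); rewrite UE inE.
Qed.
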